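(* Let $A,B$ be Hermitian matrices in $\mathbb{M}_d$. Then $$(A\vee B)\oplus(A\wedge B)\simeq A\oplus B,$$ where $A\vee B$ and $A\wedge B$ are the supremum and infimum of $A$ and $B$ in the spectral order, and $\simeq$ denotes unitary equivalence of $2d\times 2d$ matrices.
   Context: $\mathbb{M}_d$ is the algebra of complex $d\times d$ matrices. For a Hermitian $X\in\mathbb{M}_d$ and $t\in\mathbb{R}$, $E_X(t)=\mathbf{1}_{(t,\infty)}(X)$ is the orthogonal projection onto the span of the eigenvectors of $X$ with eigenvalue $>t$. The spectral order on Hermitian matrices is: $A\preceq B$ iff $E_A(t)\le E_B(t)$ for all $t\in\mathbb{R}$. With this order the Hermitian matrices in $\mathbb{M}_d$ form a lattice (Olson); $A\vee B$ and $A\wedge B$ denote the supremum (join) and infimum (meet). They are characterized by $E_{A\vee B}(t)=E_A(t)\vee E_B(t)$ and $E_{A\wedge B}(t)=E_A(t)\wedge E_B(t)$ for all $t\in\mathbb{R}$, where for orthogonal projections $P,Q$ the projections $P\vee Q$ and $P\wedge Q$ are the orthogonal projections onto $\operatorname{Ran}P+\operatorname{Ran}Q$ and $\operatorname{Ran}P\cap\operatorname{Ran}Q$, respectively. $X\oplus Y$ is the block-diagonal matrix with blocks $X,Y$. $X\simeq Y$ means $X=UYU^*$ for some unitary matrix $U$. *)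

(* Defs.v *)
From HB Require Import structures.
From mathcomp Require Import all_boot all_order all_algebra.
From mathcomp Require Import boolp classical_sets reals.
From mathcomp Require Import sesquilinear spectral complex.

Set Implicit Arguments.
Unset Strict Implicit.
Unset Printing Implicit Defensive.

Import Order.TTheory GRing.Theory Num.Theory.

Local Open Scope ring_scope.
Local Open Scope complex_scope.
Local Open Scope sesquilinear_scope.

(* Vectors are rows and matrices act on the right, so [v] stands for the column
   vector [v^t*].  For Hermitian [X], [v *m X = a *: v] is equivalent (for real
   [a]) to [X *m v^t* = a *: v^t*], and the orthogonal projection onto a space
   of rows is the same matrix as the orthogonal projection onto the
   corresponding space of columns. *)

(* 1_(t, +oo)(X), for Hermitian X.  The entries of [spectral_diag X] are the
   eigenvalues of X, which are real; [t%:C < z] in R[i] means that z is real and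
   larger than t. *)
Definition spectral_proj (R : realType) (d : nat) (X : 'M[R[i]]_d) (t : R) :
    'M[R[i]]_d :=
  proj_ortho (\sum_(i < d | (t%:C < spectral_diag X 0 i)%R)
                eigenspace X (spectral_diag X 0 i))%MS.

(* [Q - P] is positive semidefinite. *)
Definition loewner_le (R : realType) (d : nat) (P Q : 'M[R[i]]_d) : Prop :=
  forall v : 'rV[R[i]]_d, 0 <= (v *m (Q - P) *m v^t*) 0 0.

Definition spectral_le (R : realType) (d : nat) (A B : 'M[R[i]]_d) : Prop :=
  forall t : R, loewner_le (spectral_proj A t) (spectral_proj B t).

Definition is_spectral_sup (R : realType) (d : nat) (A B J : 'M[R[i]]_d) :
    Prop :=
  [/\ J \is hermsymmx, spectral_le A J, spectral_le B J &
      forall K : 'M[R[i]]_d, K \is hermsymmx ->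
        spectral_le A K -> spectral_le B K -> spectral_le J K].

Definition is_spectral_inf (R : realType) (d : nat) (A B M : 'M[R[i]]_d) :
    Prop :=
  [/\ M \is hermsymmx, spectral_le M A, spectral_le M B &
      forall K : 'M[R[i]]_d, K \is hermsymmx ->
        spectral_le K A -> spectral_le K B -> spectral_le K M].

(* The default value 0 of [xget] is never used for Hermitian A and B: their
   supremum and infimum exist (Olson), and they are unique because the spectral
   order is antisymmetric on Hermitian matrices. *)
Definition spectral_join (R : realType) (d : nat) (A B : 'M[R[i]]_d) :
    'M[R[i]]_d :=
  xget 0 [set J | is_spectral_sup A B J]%classic.

Definition spectral_meet (R : realType) (d : nat) (A B : 'M[R[i]]_d) :
    'M[R[i]]_d :=
  xget 0 [set M | is_spectral_inf A B M]%classic.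

Definition unitarily_equivalent (R : realType) (n : nat) (X Y : 'M[R[i]]_n) :
    Prop :=
  exists2 U : 'M[R[i]]_n, U \is unitarymx & X = U *m Y *m U^t*.

(* Main.v *)
Require Import Defs.
From mathcomp Require Import all_boot all_order all_algebra fingroup perm.
From mathcomp Require Import boolp classical_sets.
From mathcomp Require Import reals sesquilinear spectral complex.

(** Write S_X(t) for the sum of the eigenspaces of X with eigenvalue > t.  For
    orthogonal projections the Loewner order is inclusion of ranges
    ([loewner_le_proj_ortho]), so the spectral order of A and B is the inclusion
    of S_A(t) in S_B(t) for all t.

    The families t |-> S_A(t) + S_B(t) and t |-> S_A(t) :&: S_B(t) are
    decreasing step functions with jumps at eigenvalues of A and B only, full
    for small t and zero for large t.  Every such family is the family S_X of
    some Hermitian X ([spectral_family_realised]): with x_0 <= ... <= x_(n-1)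
    its jumps and V_0 >= V_1 >= ... >= V_n its successive values, take
    X = sum_k x_k (P_(V_k) - P_(V_(k+1))).  Hence the supremum J and the infimum
    M exist, and antisymmetry gives
      S_J(t) = S_A(t) + S_B(t),  S_M(t) = S_A(t) :&: S_B(t)
    ([spectral_joinP], [spectral_meetP]).

    The rank of S_X(t) is the number of eigenvalues of X above t, counted with
    multiplicity ([rank_spectral_space]).  Therefore the dimension formula
    dim (U + V) + dim (U :&: V) = dim U + dim V says that, above every t, J and
    M have together as many eigenvalues as A and B.  This determines the
    multiset of eigenvalues ([perm_eq_count_gt]), and the eigenvalues with their
    multiplicities determine a Hermitian matrix up to unitary equivalence. *)

Set Implicit Arguments.
Unset Strict Implicit.
Unset Printing Implicit Defensive.
Import Order.TTheory GRing.Theory Num.Theory.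
Local Open Scope ring_scope.
Local Open Scope complex_scope.
Local Open Scope sesquilinear_scope.

Local Notation "B ^!" :=
  (orthomx Num.conj (mx_of_hermitian (hermitian1mx _)) B) : matrix_set_scope.

(** * Hermitian matrices and orthogonal projections *)

Section Hermitian.
Variable C : numClosedFieldType.

Lemma adjmxM m n p (X : 'M[C]_(m, n)) (Y : 'M[C]_(n, p)) :
  (X *m Y)^t* = Y^t* *m X^t*.
Proof. by rewrite trmx_mul map_mxM. Qed.

Lemma hermsymmxP n (X : 'M[C]_n) : reflect (X^t* = X) (X \is hermsymmx).
Proof.
apply: (iffP (is_hermitianmxP _ _ _)); rewrite expr0 scale1r.
  by move=> {2}->.
by move=> ->.
Qed.

(** The rows of 1 - P are orthogonal to U, which contains the rows of P; so
    (1 - P) P^* = 0, i.e. P^* = P P^*, and the right-hand side is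
    self-adjoint. *)
Lemma proj_ortho_adj m n (U : 'M[C]_(m, n)) : (proj_ortho U)^t* = proj_ortho U.
Proof.
have sPU : (proj_ortho U <= U)%MS.
  by rewrite -[X in (X <= _)%MS]mul1mx proj_ortho_sub.
have : (1%:M - proj_ortho U) *m (proj_ortho U)^t* = 0.
  apply/orthomx1P; rewrite -[X in (_ - X)%R]mul1mx.
  apply: submx_trans (proj_ortho_compl_sub _ _) _.
  by rewrite submx_ortho.
rewrite mulmxBl mul1mx => /subr0_eq E.
(* [proj_ortho U] is itself a matrix product, which [adjmxM] would unfold. *)
move: (proj_ortho U) E => P E.
by rewrite -[RHS]trmxCK [in RHS]E adjmxM trmxCK -E.
Qed.

Lemma ortho_decomposition m n (V : 'M[C]_(m, n)) (v : 'rV[C]_n) :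
  exists a b : 'rV[C]_n,
    [/\ (a <= V)%MS, a *m b^t* = 0, a + b = v & v *m proj_ortho V = a].
Proof.
exists (v *m proj_ortho V), (v *m proj_ortho V^!%MS).
split; [exact: proj_ortho_sub | | exact: add_proj_ortho | by []].
by apply/orthomx1P; rewrite orthomx_proj_mx_ortho // ortho_mx_ortho.
Qed.

Lemma dot_ge0 n (v : 'rV[C]_n) : 0 <= (v *m v^t*) 0 0.
Proof. by rewrite -dotmxE dnorm_ge0. Qed.

(** For eigenvectors u and v of a and b, u X v^* is both (u X) v^* = a u v^* and
    u (v X)^* = b u v^*, because b is real. *)
Lemma eigenspace_orthomx n (X : 'M[C]_n) (a b : C) :
  X \is hermsymmx -> b \is Num.real -> a != b ->
  (eigenspace X a <= (eigenspace X b)^!)%MS.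
Proof.
move=> /hermsymmxP hX /CrealP hb ab; apply/orthomx1P.
have ea : eigenspace X a *m X = a *: eigenspace X a by apply/eigenspaceP.
have eb : eigenspace X b *m X = b *: eigenspace X b by apply/eigenspaceP.
have eb' : X *m (eigenspace X b)^t* = b *: (eigenspace X b)^t*.
  rewrite -[X in X *m _]hX -adjmxM eb.
  by apply/matrixP => i j; rewrite !mxE rmorphM/= hb.
have := congr1 (mulmx (eigenspace X a)) eb'.
rewrite mulmxA ea -scalemxAl -scalemxAr.
move/eqP; rewrite -subr_eq0 -scalerBl scalemx_eq0 subr_eq0 (negPf ab) /=.
by move/eqP.
Qed.

Lemma eqmx_of_ortho m n p (U : 'M[C]_(m, n)) (V : 'M[C]_(p, n)) :
  (U <= V)%MS -> (U^! <= V^!)%MS -> (U :=: V)%MS.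
Proof. by rewrite submx_ortho => UV VU; apply/eqmxP/andP. Qed.

Lemma spectral_decomposition n (X : 'M[C]_n) : X \is hermsymmx ->
  X = (spectralmx X)^t* *m diag_mx (spectral_diag X) *m spectralmx X.
Proof.
by move=> /hermitian_normalmx /orthomx_spectralP {1}->;
  rewrite invmx_unitary ?spectral_unitarymx.
Qed.

Lemma row_spectralmx_eigen n (X : 'M[C]_n) i : X \is hermsymmx ->
  (row i (spectralmx X) <= eigenspace X (spectral_diag X 0 i))%MS.
Proof.
move=> hX; apply/eigenspaceP; rewrite -row_mul {2}(spectral_decomposition hX).
rewrite !mulmxA (unitarymxP _) ?spectral_unitarymx // mul1mx.
by rewrite row_mul row_diag_mx -scalemxAl -rowE.
Qed.

(** In the coordinates of an orthonormal eigenbasis, an eigenvector for a is a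
    nonzero w with w_i lambda_i = a w_i for all i. *)
Lemma eigenvalue_spectral_diag n (X : 'M[C]_n) a : X \is hermsymmx ->
  eigenvalue X a -> exists i, spectral_diag X 0 i = a.
Proof.
move=> hX /eigenvalueP [v va vN0].
pose w := v *m (spectralmx X)^t*.
have wD : w *m diag_mx (spectral_diag X) = a *: w.
  move: va; rewrite {1}(spectral_decomposition hX).
  move/(congr1 (fun u => u *m (spectralmx X)^t*)).
  by rewrite -scalemxAl !mulmxA mulmxtVK ?spectral_unitarymx.
have /rV0Pn [i wi] : w != 0.
  apply: contraNneq vN0 => w0.
  by rewrite -(mulmxKtV v (spectral_unitarymx X) erefl) -/w w0 mul0mx.
exists i; apply: (mulfI wi).
by move/matrixP/(_ 0 i): wD; rewrite mul_mx_diag !mxE => ->; rewrite mulrC.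
Qed.

Lemma mxrank_sum_rows n (P : 'M[C]_n) (Q : pred 'I_n) : P \in unitmx ->
  \rank (\sum_(i | Q i) <<row i P>>)%MS = #|Q|.
Proof.
move=> Pu.
have -> : \rank (\sum_(i | Q i) <<row i P>>)%MS =
   \rank ((\sum_(i | Q i) <<delta_mx 0 i : 'rV[C]_n>>)%MS *m P).
  apply: eqmx_rank; rewrite !sumsmxMr.
  by apply/andP; split; apply/sumsmx_subP => i Qi; apply: (sumsmx_sup i) => //;
    rewrite genmxE ?(eqmxMr _ (genmxE _)) rowE ?genmxE.
rewrite mxrankMfree ?row_free_unit // (mxdirectP _) /=; last first.
  exact: mxdirect_delta.
under eq_bigr do rewrite genmxE mxrank_delta.
by rewrite sum1_card.
Qed.

End Hermitian.

(** * Unitary equivalence *)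

Section Unitary.
Variable R : realType.

Lemma unitarily_equivalent_trans n (X Y Z : 'M[R[i]]_n) :
  unitarily_equivalent X Y -> unitarily_equivalent Y Z ->
  unitarily_equivalent X Z.
Proof.
move=> [U hU ->] [V hV ->]; exists (U *m V).
  exact: mul_unitarymx hU hV.
by rewrite adjmxM !mulmxA.
Qed.

Lemma unitarily_equivalent_sym n (X Y : 'M[R[i]]_n) :
  unitarily_equivalent X Y -> unitarily_equivalent Y X.
Proof.
move=> [U hU ->]; exists (U^t*); first by rewrite trmxC_unitary.
have hU' : U^t* *m U = 1%:M by rewrite -[X in X *m U]mul1mx mulmxKtV.
by rewrite trmxCK !mulmxA hU' mul1mx -mulmxA hU' mulmx1.
Qed.

Lemma unitarily_equivalent_spectral n (X : 'M[R[i]]_n) : X \is hermsymmx ->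
  unitarily_equivalent X (diag_mx (spectral_diag X)).
Proof.
move=> hX; exists ((spectralmx X)^t*).
  by rewrite trmxC_unitary spectral_unitarymx.
by rewrite trmxCK; exact: spectral_decomposition.
Qed.

Lemma unitarily_equivalent_block n m (X X' : 'M[R[i]]_n) (Y Y' : 'M[R[i]]_m) :
  unitarily_equivalent X X' -> unitarily_equivalent Y Y' ->
  unitarily_equivalent (block_mx X 0 0 Y) (block_mx X' 0 0 Y').
Proof.
move=> [U /unitarymxP hU ->] [V /unitarymxP hV ->].
have adj : (block_mx U 0 0 V)^t* = block_mx (U^t*) 0 0 (V^t*).
  by rewrite tr_block_mx map_block_mx !trmx0 !map_mx0.
exists (block_mx U 0 0 V).
  apply/unitarymxP; rewrite adj mulmx_block.
  by rewrite !(mulmx0, mul0mx, addr0, add0r) hU hV -scalar_mx_block.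
by rewrite adj !mulmx_block !(mulmx0, mul0mx, addr0, add0r).
Qed.

Lemma enum_split_ord m n :
  enum 'I_(m + n) =
  [seq lshift n i | i <- enum 'I_m] ++ [seq rshift m i | i <- enum 'I_n].
Proof.
apply: (inj_map val_inj); rewrite val_enum_ord iotaD map_cat -(map_comp val).
rewrite -[X in _ = _ ++ X]map_comp.
congr cat; first by rewrite -val_enum_ord; apply: eq_map.
rewrite add0n -[X in iota X]addn0 iotaDl -val_enum_ord -(map_comp (addn m)).
exact: eq_map.
Qed.

Lemma unitarily_equivalent_diag n (u v : 'rV[R[i]]_n) :
  perm_eq [seq u 0 i | i <- enum 'I_n] [seq v 0 i | i <- enum 'I_n] ->
  unitarily_equivalent (diag_mx u) (diag_mx v).
Proof.
move=> uv; have /tuple_permP [s us] :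
  perm_eq [seq u 0 i | i <- enum 'I_n] [tuple v 0 i | i < n] by [].
have uE i : u 0 i = v 0 (s i).
  have /(congr1 (fun r => nth 0 r i)) := us.
  rewrite (nth_map i) ?size_enum_ord // nth_ord_enum => ->.
  rewrite (nth_map i) ?size_enum_ord // nth_ord_enum.
  by rewrite tnth_mktuple.
have permT : (perm_mx s : 'M[R[i]]_n)^t* = (perm_mx s)^T.
  by apply/matrixP => i j; rewrite !mxE conjC_nat.
exists (perm_mx s).
  by apply/unitarymxP; rewrite permT tr_perm_mx -perm_mxM mulgV perm_mx1.
(* [col_permE] multiplies by the matrix of the inverse permutation. *)
rewrite permT tr_perm_mx -row_permE -[s in RHS]invgK -col_permE.
by apply/matrixP => i j; rewrite !mxE uE invgK (inj_eq perm_inj).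
Qed.

End Unitary.

(** * Multisets of reals *)

Section Counting.
Variable R : realType.
Implicit Types (s : seq R) (a t : R).

Lemma threshold_below s a :
  exists2 t, t < a & {in s, forall x, (t < x) = (a <= x)}.
Proof.
elim: s => [|x s [t ta ts]]; first by exists (a - 1); rewrite ?ltrBlDr ?ltrDl.
have [xa|ax] := ltP x a; last first.
  exists t => // y; rewrite inE => /predU1P [->|/ts//].
  by rewrite ax (lt_le_trans ta).
exists (Num.max t x) => [|y]; first by rewrite gt_max ta.
rewrite gt_max inE => /predU1P [->|/ts ->].
  by rewrite ltxx andbF leNgt xa.
by case: (leP a y) => //= ay; rewrite (lt_le_trans xa ay).
Qed.

(** The multiplicity of a is the number of entries >= a minus the number of
    entries > a, and the former is the number of entries > t for any t slightly
    below a. *)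
Lemma perm_eq_count_gt s1 s2 :
  (forall t, count (fun x => t < x) s1 = count (fun x => t < x) s2) ->
  perm_eq s1 s2.
Proof.
move=> E; apply/allP => a _ /=; apply/eqP.
have count_le s : count (fun x => a <= x) s =
    (count_mem a s + count (fun x => (a < x)%R) s)%N.
  elim: s => //= x s ->.
  rewrite le_eqVlt eq_sym; case: eqVneq => [->|_] /=; last by rewrite addnCA.
  by rewrite ltxx addnA.
have [t _ ts] := threshold_below (s1 ++ s2) a.
apply/eqP; rewrite -(eqn_add2r (count (fun x => a < x) s1)) {2}E -!count_le.
have <- : count (fun x => t < x) s1 = count (fun x => a <= x) s1.
  by apply: eq_in_count => x xs; apply: ts; rewrite mem_cat xs.
have <- : count (fun x => t < x) s2 = count (fun x => a <= x) s2.
  by apply: eq_in_count => x xs; apply: ts; rewrite mem_cat xs orbT.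
by rewrite E.
Qed.

End Counting.

(** * Spectral subspaces *)

Section Spectral.
Variables (R : realType) (d : nat).
Implicit Types (X A B J : 'M[R[i]]_d) (t : R).

(** [spectral_proj X t] is by definition the projection onto this space. *)
Definition spectral_space X t : 'M[R[i]]_d :=
  (\sum_(i < d | (t%:C < spectral_diag X 0 i)%R)
      eigenspace X (spectral_diag X 0 i))%MS.

Definition eigenvals X : seq R :=
  [seq complex.Re (spectral_diag X 0 i) | i <- enum 'I_d].

Lemma size_eigenvals X : size (eigenvals X) = d.
Proof. by rewrite size_map size_enum_ord. Qed.

Lemma spectral_diag_real X i : X \is hermsymmx ->
  spectral_diag X 0 i = (complex.Re (spectral_diag X 0 i))%:C.
Proof.
move=> /hermitian_spectral_diag_real /mxOverP /(_ 0 i).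
by move/RRe_real.
Qed.

Lemma eigenspace_sub_spectral X (a t : R) : X \is hermsymmx -> t < a ->
  (eigenspace X a%:C <= spectral_space X t)%MS.
Proof.
move=> hX ta; have [->|aX] := eqVneq (eigenspace X a%:C) 0; first exact: sub0mx.
have [i ia] := eigenvalue_spectral_diag hX aX.
by apply: (sumsmx_sup i); rewrite ia ?ltcR.
Qed.

Lemma eigenspace_ortho_spectral X (a t : R) : X \is hermsymmx -> a <= t ->
  (eigenspace X a%:C <= (spectral_space X t)^!)%MS.
Proof.
move=> hX at_; rewrite orthomx_sym; apply/sumsmx_subP => i ti.
apply: eigenspace_orthomx => //; first by rewrite complex_real eqxx.
move: ti; rewrite (spectral_diag_real _ hX) ltcR => ti.
by rewrite (inj_eq (@complexI _)) gt_eqF // (le_lt_trans at_).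
Qed.

(** The eigenvectors of an orthonormal eigenbasis with eigenvalue > t lie in
    S_X(t) and the others in its orthogonal complement.  This bounds the rank of
    each of the two spaces from below, and both ranks add up to d. *)
Lemma rank_spectral_space X t : X \is hermsymmx ->
  \rank (spectral_space X t) = count (fun x => t < x) (eigenvals X).
Proof.
move=> hX; rewrite count_map.
pose Q := [pred i | t < complex.Re (spectral_diag X 0 i)].
have -> : count Q (enum 'I_d) = #|Q| by rewrite cardE size_filter enumT.
have tE i : (t%:C < spectral_diag X 0 i) = Q i.
  by rewrite (spectral_diag_real _ hX) ltcR.
have above : (#|Q| <= \rank (spectral_space X t))%N.
  rewrite -(mxrank_sum_rows Q (spectral_unit X)); apply: mxrankS.
  apply/sumsmx_subP => i Qi; rewrite genmxE.
  apply: (sumsmx_sup i); first by rewrite tE.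
  exact: row_spectralmx_eigen.
have below : (#|[predC Q]| <= \rank (spectral_space X t)^!)%N.
  rewrite -(mxrank_sum_rows [predC Q] (spectral_unit X)); apply: mxrankS.
  apply/sumsmx_subP => i /= Qi; rewrite genmxE.
  apply: submx_trans (row_spectralmx_eigen i hX) _.
  rewrite (spectral_diag_real i hX).
  by apply: eigenspace_ortho_spectral; rewrite // leNgt.
apply/eqP; rewrite eqn_leq above andbT -(leq_add2r #|[predC Q]|) cardC card_ord.
by rewrite -[X in (_ <= X)%N](add_rank_ortho (spectral_space X t)) leq_add2l.
Qed.

(** Let P and Q be the projections.  For v in U, write v = a + b with a in V and
    b orthogonal to V: then v (Q - P) v^* = - b b^*, so positivity forces b = 0.
    Conversely, if U is inside V then Q - P is self-adjoint and idempotent, so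
    v (Q - P) v^* = (v (Q - P)) (v (Q - P))^*. *)
Lemma loewner_le_proj_ortho (U V : 'M[R[i]]_d) :
  loewner_le (proj_ortho U) (proj_ortho V) <-> (U <= V)%MS.
Proof.
split=> [leUV|UV v].
  apply/rV_subP => v vU; have := leUV v; rewrite mulmxBr => {leUV}.
  have [a [b [aV ab vab ->]]] := ortho_decomposition V v.
  have -> : v *m proj_ortho U = v by exact: proj_ortho_id.
  have ba : b *m a^t* = 0.
    by rewrite -[LHS]trmxCK adjmxM trmxCK ab trmx0 map_mx0.
  have -> : (a - v) *m v^t* = - (b *m b^t*).
    have -> : a - v = - b by rewrite -vab opprD addrA subrr add0r.
    by rewrite -vab linearD/= map_mxD mulmxDr !mulNmx ba oppr0 add0r.
  rewrite mxE oppr_ge0 -dotmxE => b_le0.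
  have /eqP : dotmx b b = 0 by apply/le_anti; rewrite b_le0 dnorm_ge0.
  rewrite dnorm_eq0 => /eqP b0.
  by rewrite -vab b0 addr0.
have PQ : proj_ortho U *m proj_ortho V = proj_ortho U.
  by rewrite proj_ortho_id // proj_orthoE.
move: (proj_ortho_adj U) (proj_ortho_adj V).
move: (proj_ortho_proj U) (proj_ortho_proj V) PQ.
move: (proj_ortho U) (proj_ortho V) => P Q /= PP QQ PQ Pa Qa.
have QP : Q *m P = P by rewrite -[RHS]Pa -[in RHS]PQ adjmxM Pa Qa.
have Da : (Q - P)^t* = Q - P by rewrite linearB/= map_mxB Pa Qa.
have DD : (Q - P) *m (Q - P) = Q - P.
  by rewrite mulmxBl !mulmxBr QQ PQ QP PP subrr subr0.
by rewrite -DD mulmxA -[X in _ *m X *m _]Da -mulmxA -adjmxM dot_ge0.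
Qed.

Lemma spectral_leP A B :
  spectral_le A B <-> forall t, (spectral_space A t <= spectral_space B t)%MS.
Proof.
by split=> AB t; apply/loewner_le_proj_ortho; exact: AB.
Qed.

(** * Families of spectral subspaces *)

(** The second clause says that F jumps only at entries of s: it is constant on
    a set of thresholds which no entry of s separates. *)
Definition spectral_family (s : seq R) (F : R -> 'M[R[i]]_d) :=
  [/\ forall t u, t <= u -> (F u <= F t)%MS,
      forall t u, {in s, forall x, (x <= t) = (x <= u)} -> (F t <= F u)%MS,
      forall t, {in s, forall x, t < x} -> (1%:M <= F t)%MS &
      forall t, {in s, forall x, x <= t} -> F t = 0].

Lemma spectral_space_family X s :
  X \is hermsymmx -> {subset eigenvals X <= s} ->
  spectral_family s (spectral_space X).
Proof.
move=> hX Xs.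
have mem i : complex.Re (spectral_diag X 0 i) \in s.
  by apply/Xs/map_f; rewrite mem_enum.
have tE t i :
    (t%:C < spectral_diag X 0 i) = (t < complex.Re (spectral_diag X 0 i)).
  by rewrite (spectral_diag_real _ hX) ltcR.
split=> [t u tu|t u tu|t ts|t ts].
- apply/sumsmx_subP => i; rewrite tE => ui; apply: (sumsmx_sup i) => //.
  by rewrite tE (le_lt_trans tu).
- apply/sumsmx_subP => i; rewrite tE ltNge tu // => ui.
  apply: (sumsmx_sup i) => //.
  by rewrite tE ltNge.
- rewrite -mxrank_leqif_sup ?submx1 // mxrank1 rank_spectral_space //.
  rewrite -{1}(size_eigenvals X) -all_count.
  by apply/allP => x /Xs /ts.
- apply/eqP; rewrite -mxrank_eq0 rank_spectral_space //.
  rewrite -leqn0 leqNgt -has_count.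
  by apply/hasPn => x /Xs /ts; rewrite leNgt.
Qed.

Lemma adds_spectral_family s F G : spectral_family s F -> spectral_family s G ->
  spectral_family s (fun t => F t + G t)%MS.
Proof.
move=> [F1 F2 F3 F4] [G1 G2 G3 G4]; split=> [t u tu|t u tu|t ts|t ts].
- by rewrite addsmxS ?F1 ?G1.
- by rewrite addsmxS ?F2 ?G2.
- by rewrite (submx_trans (F3 t ts)) ?addsmxSl.
- by rewrite F4 ?G4 // addsmx0_id.
Qed.

Lemma cap_spectral_family s F G : spectral_family s F -> spectral_family s G ->
  spectral_family s (fun t => F t :&: G t)%MS.
Proof.
move=> [F1 F2 F3 F4] [G1 G2 G3 G4]; split=> [t u tu|t u tu|t ts|t ts].
- by rewrite capmxS ?F1 ?G1.
- by rewrite capmxS ?F2 ?G2.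
- by rewrite sub_capmx F3 ?G3.
- by apply/eqP; rewrite -submx0 -[X in (_ <= X)%MS](F4 t ts) capmxSl.
Qed.

(** One step of a flag: a complement of V in U can be taken orthogonal to V. *)
Lemma sub_adds_cap_ortho m n (U : 'M[R[i]]_(m, d)) (V : 'M_(n, d)) :
  (V <= U)%MS -> (U <= V + (U :&: V^!))%MS.
Proof.
move=> VU; rewrite -[X in (X <= _)%MS](addrNK (U *m proj_ortho V)) addrC.
rewrite addmx_sub_adds ?proj_ortho_sub // sub_capmx proj_ortho_compl_sub andbT.
by rewrite addmx_sub // eqmx_opp (submx_trans (proj_ortho_sub _ _)).
Qed.

(** X acts as the scalar x_k on V_k :&: V_(k+1)^!, the part of the space lost at
    the jump x_k: of the terms of the sum defining X, only the k-th survives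
    there.  If j counts the jumps that are <= t, then V_j = F t is built from
    the pieces k >= j, which lie in eigenspaces with eigenvalue > t, and its
    orthogonal complement from the pieces k < j, which lie in eigenspaces with
    eigenvalue <= t.  So F t and its complement are contained in S_X(t) and in
    the complement of S_X(t), which forces equality. *)
Lemma spectral_family_realised s F : spectral_family s F ->
  exists2 X, X \is hermsymmx & forall t, (spectral_space X t :=: F t)%MS.
Proof.
move=> [F_dec F_const F_low F_high].
pose s' := sort <=%R s; pose n := size s'; pose x_ k := nth 0 s' k.
have s'_sorted : sorted <=%R s' by apply: sort_sorted; exact: le_total.
have mem_s' y : y \in s -> exists2 k, (k < n)%N & y = x_ k.
  by rewrite -(mem_sort <=%R) => /(nthP 0) [k kn <-]; exists k.
have x_le k m : (m < n)%N -> (k <= m)%N -> x_ k <= x_ m.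
  move=> mn km; rewrite (sorted_leq_nth le_trans lexx) ?inE //.
  exact: leq_ltn_trans km mn.
pose V k := if k is k'.+1 then F (x_ k') else 1%:M.
have V_dec k m : (m <= n)%N -> (k <= m)%N -> (V m <= V k)%MS.
  case: k m => [|k] [|m] //=; rewrite ?submx1 // => mn km.
  by apply: F_dec; apply: x_le.
have V_n : V n = 0.
  have [n0|n_gt0] := posnP n.
    (* Without jumps F is both full and zero, so the whole space is zero. *)
    have s_nil y : y \in s -> False by case/mem_s' => k; rewrite n0.
    rewrite n0 /=; apply/eqP; rewrite -submx0 -(F_high 0) ?F_low //;
      by move=> y /s_nil.
  rewrite -(prednK n_gt0) /=; apply: F_high => y /mem_s' [k kn ->].
  by apply: x_le; rewrite -ltnS prednK.
have [P [P_adj P_id P_0]] : exists P : nat -> 'M[R[i]]_d,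
    [/\ forall k, (P k)^t* = P k,
        forall k (W : 'M_d), (W <= V k)%MS -> W *m P k = W &
        forall k (W : 'M_d), (W <= (V k)^!)%MS -> W *m P k = 0].
  exists (fun k => proj_ortho (V k)); split=> k; first exact: proj_ortho_adj.
    by move=> W; exact: proj_ortho_id.
  by move=> W; exact: proj_ortho_0.
pose X := \sum_(k < n) (x_ k)%:C *: (P k - P k.+1).
have X_herm : X \is hermsymmx.
  apply/hermsymmxP; apply: (big_ind (fun Y : 'M_d => Y^t* = Y)).
  - by rewrite trmx0 map_mx0.
  - by move=> Y Z hY hZ; rewrite linearD/= map_mxD hY hZ.
  - move=> k _.
    have DH : (P k - P k.+1)^t* = P k - P k.+1.
      by rewrite linearB/= map_mxB !P_adj.
    rewrite -{2}DH; apply/matrixP => a b; rewrite !mxE rmorphM/=.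
    by congr (_ * _); apply/CrealP; rewrite complex_real eqxx.
have X_eig k : (k < n)%N ->
    (V k :&: (V k.+1)^! <= eigenspace X (x_ k)%:C)%MS.
  move=> kn; apply/eigenspaceP; set W := (V k :&: _)%MS.
  have WP m : (m <= n)%N -> W *m P m = if (m <= k)%N then W else 0.
    move=> mn; case: leqP => mk.
      apply: P_id; apply: submx_trans (capmxSl _ _) _.
      exact: V_dec (ltnW kn) mk.
    apply: P_0; apply: submx_trans (capmxSr _ _) _.
    by rewrite submx_ortho; exact: V_dec.
  rewrite mulmx_sumr (bigD1 (Ordinal kn)) //= big1 => [|m /eqP mk].
    rewrite addr0 -scalemxAr mulmxBr (WP _ (ltnW kn)) (WP _ kn).
    by rewrite leqnn ltnn subr0.
  have {}mk : val m != k by apply: contra_not_neq mk => mk'; apply: val_inj.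
  rewrite -scalemxAr mulmxBr (WP _ (ltnW (ltn_ord m))) (WP _ (ltn_ord m)).
  rewrite leq_eqVlt (negPf mk) /=.
  by rewrite subrr scaler0.
exists X => // u; pose j := count (<= u) s'.
have jn : (j <= n)%N by exact: count_size.
have x_low k : (k < j)%N -> x_ k <= u by move=> kj; apply: nth_count_le.
have x_high k : (j <= k)%N -> (k < n)%N -> u < x_ k.
  by move=> jk kn; apply: nth_count_gt => //; rewrite jk.
have V_F : (V j :=: F u)%MS.
  apply/eqmxP; move: x_low x_high jn; rewrite /V.
  case: j => [_ xh _|m xl xh mn].
    by rewrite submx1 F_low // => y /mem_s' [k kn ->]; apply: xh.
  have E : {in s, forall x, (x <= x_ m) = (x <= u)}.
    move=> _ /mem_s' [k kn ->]; have [km|mk] := leqP k m.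
      by rewrite x_le // xl.
    rewrite [RHS]leNgt xh //=; apply/negbTE; rewrite -ltNge.
    by rewrite (le_lt_trans (xl m _)) // xh.
  by rewrite !F_const // => x /E.
apply: eqmx_trans V_F; apply/eqmx_sym/eqmx_of_ortho.
  have down m : forall k, (n - k)%N = m -> (j <= k <= n)%N ->
      (V k <= spectral_space X u)%MS.
    elim: m => [|m IH] k nk /andP[jk kn].
      have -> : k = n by apply/eqP; rewrite eqn_leq kn -subn_eq0 nk.
      by rewrite V_n sub0mx.
    have kn' : (k < n)%N by rewrite -subn_gt0 nk.
    apply: submx_trans (sub_adds_cap_ortho (V_dec _ _ kn' (leqnSn k))) _.
    rewrite addsmx_sub IH ?(leqW jk) //; last by rewrite subnS nk.
    apply: submx_trans (X_eig _ kn') _.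
    by apply: eigenspace_sub_spectral => //; apply: x_high.
  by apply: (down (n - j)%N); rewrite ?leqnn.
have up k : (k <= j)%N -> ((V k)^! <= (spectral_space X u)^!)%MS.
  elim: k => [|k IH] kj; first by rewrite submx_ortho submx1.
  have kn : (k < n)%N by apply: leq_trans kj jn.
  have VV : ((V k)^! <= (V k.+1)^!)%MS by rewrite submx_ortho V_dec.
  apply: submx_trans (sub_adds_cap_ortho VV) _.
  rewrite addsmx_sub; apply/andP; split; first exact: IH (ltnW kj).
  apply: submx_trans (_ : _ <= V k :&: (V k.+1)^!)%MS _.
    rewrite sub_capmx capmxSl andbT; apply: submx_trans (capmxSr _ _) _.
    by rewrite ortho_id.
  apply: submx_trans (X_eig _ kn) _.
  by apply: eigenspace_ortho_spectral => //; apply: x_low.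
exact: up.
Qed.

(** * Supremum and infimum in the spectral order *)

Lemma mem_eigenvals2 A B :
  {subset eigenvals A <= eigenvals A ++ eigenvals B} /\
  {subset eigenvals B <= eigenvals A ++ eigenvals B}.
Proof. by split=> x xA; rewrite mem_cat xA ?orbT. Qed.

Lemma spectral_sup_exists A B : A \is hermsymmx -> B \is hermsymmx ->
  exists2 J, is_spectral_sup A B J &
    forall t,
      (spectral_space J t :=: spectral_space A t + spectral_space B t)%MS.
Proof.
move=> hA hB; have [sA sB] := mem_eigenvals2 A B.
have [J hJ JE] := spectral_family_realised (adds_spectral_family
  (spectral_space_family hA sA) (spectral_space_family hB sB)).
exists J; last exact: JE.
split=> [|||K hK /spectral_leP AK /spectral_leP BK]; first exact: hJ.
- by apply/spectral_leP => t; rewrite JE addsmxSl.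
- by apply/spectral_leP => t; rewrite JE addsmxSr.
- apply/spectral_leP => t; rewrite (JE t) addsmx_sub.
  by apply/andP; split; [exact: AK | exact: BK].
Qed.

Lemma spectral_inf_exists A B : A \is hermsymmx -> B \is hermsymmx ->
  exists2 M, is_spectral_inf A B M &
    forall t,
      (spectral_space M t :=: spectral_space A t :&: spectral_space B t)%MS.
Proof.
move=> hA hB; have [sA sB] := mem_eigenvals2 A B.
have [M hM ME] := spectral_family_realised (cap_spectral_family
  (spectral_space_family hA sA) (spectral_space_family hB sB)).
exists M; last exact: ME.
split=> [|||K hK /spectral_leP KA /spectral_leP KB]; first exact: hM.
- by apply/spectral_leP => t; rewrite ME capmxSl.
- by apply/spectral_leP => t; rewrite ME capmxSr.
- apply/spectral_leP => t; rewrite (ME t) sub_capmx.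
  by apply/andP; split; [exact: KA | exact: KB].
Qed.

(** [spectral_join] picks some supremum; any two suprema are below each other,
    hence have the same spectral subspaces. *)
Lemma spectral_joinP A B : A \is hermsymmx -> B \is hermsymmx ->
  spectral_join A B \is hermsymmx /\
  forall t, (spectral_space (spectral_join A B) t :=:
             spectral_space A t + spectral_space B t)%MS.
Proof.
move=> hA hB; have [J J_sup JE] := spectral_sup_exists hA hB.
have : is_spectral_sup A B (spectral_join A B) by apply: (xgetPex 0); exists J.
case: J_sup => hJ AJ BJ J_least [hJ' AJ' BJ' J'_least].
have J'J := (spectral_leP _ _).1 (J'_least _ hJ AJ BJ).
have JJ' := (spectral_leP _ _).1 (J_least _ hJ' AJ' BJ').
split=> [|t]; first exact: hJ'.
apply: eqmx_trans (JE t); apply/eqmxP/andP.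
by split; [exact: J'J | exact: JJ'].
Qed.

Lemma spectral_meetP A B : A \is hermsymmx -> B \is hermsymmx ->
  spectral_meet A B \is hermsymmx /\
  forall t, (spectral_space (spectral_meet A B) t :=:
             spectral_space A t :&: spectral_space B t)%MS.
Proof.
move=> hA hB; have [M M_inf ME] := spectral_inf_exists hA hB.
have : is_spectral_inf A B (spectral_meet A B) by apply: (xgetPex 0); exists M.
case: M_inf => hM MA MB M_most [hM' MA' MB' M'_most].
have M'M := (spectral_leP _ _).1 (M_most _ hM' MA' MB').
have MM' := (spectral_leP _ _).1 (M'_most _ hM MA MB).
split=> [|t]; first exact: hM'.
apply: eqmx_trans (ME t); apply/eqmxP/andP.
by split; [exact: M'M | exact: MM'].
Qed.

(** * Eigenvalues of the supremum and the infimum *)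

(** The dimension formula for a sum and an intersection, read as a statement on
    numbers of eigenvalues above t. *)
Lemma perm_eigenvals_adds_cap A B J M :
  A \is hermsymmx -> B \is hermsymmx -> J \is hermsymmx -> M \is hermsymmx ->
  (forall t,
     (spectral_space J t :=: spectral_space A t + spectral_space B t)%MS) ->
  (forall t,
     (spectral_space M t :=: spectral_space A t :&: spectral_space B t)%MS) ->
  perm_eq (eigenvals J ++ eigenvals M) (eigenvals A ++ eigenvals B).
Proof.
move=> hA hB hJ hM JE ME; apply: perm_eq_count_gt => t; rewrite !count_cat.
rewrite -(rank_spectral_space t hJ) -(rank_spectral_space t hM).
rewrite -(rank_spectral_space t hA) -(rank_spectral_space t hB).
have rJ := eqmx_rank (introT eqmxP (JE t)).
have rM := eqmx_rank (introT eqmxP (ME t)).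
exact: etrans (congr2 addn rJ rM) (mxrank_sum_cap _ _).
Qed.

(** Both sides reduce to diagonal matrices with the same entries up to order. *)
Lemma unitarily_equivalent_perm_eigenvals A B J M :
  A \is hermsymmx -> B \is hermsymmx -> J \is hermsymmx -> M \is hermsymmx ->
  perm_eq (eigenvals J ++ eigenvals M) (eigenvals A ++ eigenvals B) ->
  unitarily_equivalent (block_mx J 0 0 M) (block_mx A 0 0 B).
Proof.
move=> hA hB hJ hM JMAB.
have diagE (X Y : 'M[R[i]]_d) : X \is hermsymmx -> Y \is hermsymmx ->
    unitarily_equivalent (block_mx X 0 0 Y)
      (diag_mx (row_mx (spectral_diag X) (spectral_diag Y))).
  by move=> hX hY; rewrite diag_mx_row; apply: unitarily_equivalent_block;
    exact: unitarily_equivalent_spectral.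
apply: unitarily_equivalent_trans (diagE _ _ hJ hM) _.
apply: unitarily_equivalent_trans _
  (unitarily_equivalent_sym (diagE _ _ hA hB)).
apply: unitarily_equivalent_diag.
have listE (X Y : 'M[R[i]]_d) : X \is hermsymmx -> Y \is hermsymmx ->
    [seq row_mx (spectral_diag X) (spectral_diag Y) 0 i | i <- enum 'I_(d + d)]
    = [seq x%:C | x <- eigenvals X ++ eigenvals Y].
  move=> hX hY; rewrite enum_split_ord !map_cat.
  congr cat; rewrite -[LHS]map_comp -[RHS]map_comp; apply: eq_map => i;
    rewrite /= ?row_mxEl ?row_mxEr.
    exact: spectral_diag_real hX.
  exact: spectral_diag_real hY.
by rewrite (listE _ _ hJ hM) (listE _ _ hA hB) perm_map.
Qed.

End Spectral.

Theorem theorem2p1 (R : realType) (d : nat) (A B : 'M[R[i]]_d)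
    (hA : A \is hermsymmx) (hB : B \is hermsymmx) :
  unitarily_equivalent
    (block_mx (spectral_join A B) 0 0 (spectral_meet A B))
    (block_mx A 0 0 B).
Proof.
have [hJ JE] := spectral_joinP hA hB.
have [hM ME] := spectral_meetP hA hB.
apply: (unitarily_equivalent_perm_eigenvals hA hB hJ hM).
exact: perm_eigenvals_adds_cap hA hB hJ hM JE ME.
Qed.
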